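(* Let $\varphi:\mathbb{R}\to\mathbb{R}$ be smooth with at most quadratic growth, and let $\Sigma$ be a properly immersed $[\varphi,\vec e_3]$-minimal surface in $\mathbb{R}^3$. Let $H_1,H_2$ be closed half-spaces of $\mathbb{R}^3$ whose boundary planes are vertical (i.e., contain the direction $\vec e_3$) and not parallel to each other. Then $\Sigma$ is not contained in $H_1\cap H_2$.
   Context: Surfaces are connected, orientable, immersed in $\mathbb{R}^3$, without boundary, with unit normal $N$; $\{\vec e_1,\vec e_2,\vec e_3\}$ is the standard basis. For a surface $\Sigma$, $\mu(p)=\langle p,\vec e_3\rangle$ is the height function and $\eta=\langle N,\vec e_3\rangle$ the angle function. Given a smooth $\varphi:\mathbb{R}\to\mathbb{R}$, $\Sigma$ is called $[\varphi,\vec e_3]$-minimal if its mean curvature vector $\vec H$ (trace of the second fundamental form, equal to the Laplacian of the position vector) satisfies $\vec H=\dot\varphi(\mu)\,\eta\,N$; equivalently, writing $\vec H=-HN$, $H=-\dot\varphi(\mu)\eta$. ''At most quadratic growth'' means there is $C>0$ with $|\dot\varphi(t)|\le C(1+|t|)$ for all $t\in\mathbb{R}$. Proper means the immersion is a proper map. *)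

(* Defs.v *)
From HB Require Import structures.
From mathcomp Require Import all_boot all_order all_algebra.
From mathcomp Require Import all_classical all_reals all_analysis.
Set Implicit Arguments. Unset Strict Implicit. Unset Printing Implicit Defensive.
Import Order.TTheory GRing.Theory Num.Theory.
Import numFieldNormedType.Exports.
Local Open Scope classical_set_scope.
Local Open Scope ring_scope.

Section Defs.
Context {R : realType}.

Notation R2 := (R * R)%type.
Notation R3 := (R * R * R)%type.

Definition dot3 (u v : R3) : R := u.1.1 * v.1.1 + u.1.2 * v.1.2 + u.2 * v.2.
Definition scale3 (a : R) (u : R3) : R3 := (a * u.1.1, a * u.1.2, a * u.2).
Definition cross3 (u v : R3) : R3 :=
  (u.1.2 * v.2 - u.2 * v.1.2, u.2 * v.1.1 - u.1.1 * v.2, u.1.1 * v.1.2 - u.1.2 * v.1.1).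

Definition pd1 (g : R2 -> R) : R2 -> R := fun z => derive1 (fun t => g (t, z.2)) z.1.
Definition pd2 (g : R2 -> R) : R2 -> R := fun z => derive1 (fun t => g (z.1, t)) z.2.

Fixpoint iter_pd (w : seq bool) (g : R2 -> R) : R2 -> R :=
  match w with
  | [::] => g
  | b :: w' => (if b then pd2 else pd1) (iter_pd w' g)
  end.

Definition smooth_on (U : set R2) (g : R2 -> R) : Prop :=
  forall (w : seq bool) (z : R2), U z ->
    [/\ {for z, continuous (iter_pd w g)},
        derivable (fun t => iter_pd w g (t, z.2)) z.1 1
      & derivable (fun t => iter_pd w g (z.1, t)) z.2 1].

Definition vpd1 (F : R2 -> R3) : R2 -> R3 := fun z =>
  (pd1 (fun y => (F y).1.1) z, pd1 (fun y => (F y).1.2) z, pd1 (fun y => (F y).2) z).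
Definition vpd2 (F : R2 -> R3) : R2 -> R3 := fun z =>
  (pd2 (fun y => (F y).1.1) z, pd2 (fun y => (F y).1.2) z, pd2 (fun y => (F y).2) z).

Definition is_chart {M : topologicalType} (U : set R2) (psi : R2 -> M) : Prop :=
  [/\ open U,
      (forall a b, U a -> U b -> psi a = psi b -> a = b),
      {within U, continuous psi}
    & (forall V, open V -> V `<=` U -> open (psi @` V))].

Definition immersion_chart {M : topologicalType} (X : M -> R3)
    (U : set R2) (psi : R2 -> M) : Prop :=
  [/\ is_chart U psi,
      smooth_on U (fun z => (X (psi z)).1.1),
      smooth_on U (fun z => (X (psi z)).1.2),
      smooth_on U (fun z => (X (psi z)).2)
    & forall z, U z -> cross3 (vpd1 (X \o psi) z) (vpd2 (X \o psi) z) <> (0, 0, 0)].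

Definition immersed_surface {M : topologicalType} (X : M -> R3) : Prop :=
  hausdorff_space M /\
  forall p : M, exists (U : set R2) (psi : R2 -> M),
    immersion_chart X U psi /\ exists2 z, U z & psi z = p.

Definition unit_normal {M : topologicalType} (X : M -> R3) (N : M -> R3) : Prop :=
  [/\ continuous N,
      (forall p, dot3 (N p) (N p) = 1)
    & forall U psi, immersion_chart X U psi -> forall z, U z ->
        dot3 (N (psi z)) (vpd1 (X \o psi) z) = 0 /\
        dot3 (N (psi z)) (vpd2 (X \o psi) z) = 0].

(** Mean curvature vector = trace of the (vector valued) second fundamental form,
    computed in a chart: ((e G - 2 f F + g E)/(E G - F^2)) N. *)
Definition mean_curv_vec {M : topologicalType} (X : M -> R3) (N : M -> R3)
    (psi : R2 -> M) (z : R2) : R3 :=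
  let Y := X \o psi in
  let Xu := vpd1 Y z in let Xv := vpd2 Y z in
  let n := N (psi z) in
  let E := dot3 Xu Xu in let F := dot3 Xu Xv in let G := dot3 Xv Xv in
  let e := dot3 (vpd1 (vpd1 Y) z) n in
  let f := dot3 (vpd2 (vpd1 Y) z) n in
  let g := dot3 (vpd2 (vpd2 Y) z) n in
  scale3 ((e * G - 2 * f * F + g * E) / (E * G - F ^+ 2)) n.

Definition phi_minimal {M : topologicalType} (phi : R -> R) (X : M -> R3)
    (N : M -> R3) : Prop :=
  forall U psi, immersion_chart X U psi -> forall z, U z ->
    mean_curv_vec X N psi z =
    scale3 (derive1 phi (X (psi z)).2 * (N (psi z)).2) (N (psi z)).

Definition proper_map {M : topologicalType} (X : M -> R3) : Prop :=
  forall K : set R3, compact K -> compact (X @^-1` K).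

(** Closed half-space {a x + b y <= c}; for (a,b) <> (0,0) its boundary plane is vertical. *)
Definition vert_halfspace (a b c : R) : set R3 :=
  [set p | a * p.1.1 + b * p.1.2 <= c].

End Defs.

(* Main.v *)
(** The drift Laplacian [L f = tr_Sigma Hess f + phi'(z) f_z] annihilates the
    horizontal coordinates, so it is at least 2 on [x^2 + y^2 + affine(x, y)],
    while [L (1 + |X|^2) = 4 + 2 z phi'(z)] is [O(1 + |X|^2)] by the growth of
    [phi'].  Choose a disc whose complement in the wedge has a bounded component
    containing the horizontal projection of a given point of the surface, and let
    [h] be the squared distance to its centre minus its squared radius.  With [S]
    the supremum of [h] over that component and [K] slightly below [S], the
    quotient [(h - K) / (1 + |X|^2)] attains a positive maximum [m] by properness.
    There [h - K - m (1 + |X|^2)] has a local maximum, so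
    [2 <= m L (1 + |X|^2) = O(m (1 + |X|^2)) = O(h - K) = O(S - K)],
    which is false for [K] close to [S]. *)
Require Import Defs.
From HB Require Import structures.
From mathcomp Require Import all_boot all_order all_algebra.
From mathcomp Require Import all_classical all_reals all_analysis.
From mathcomp Require Import ring lra.
Import Order.TTheory GRing.Theory Num.Theory.
Import numFieldNormedType.Exports.
Local Open Scope classical_set_scope.
Local Open Scope ring_scope.

(** * Taylor expansion and the second-order conditions at a local maximum *)

Lemma is_derive_affine_comp {R : realType} {g : R -> R} {x h t d : R} :
  is_derive (x + t * h) 1 g d -> is_derive t 1 (fun s => g (x + s * h)) (h * d).
Proof.
move=> gd.
have a : is_derive t 1 (fun s : R => x + s * h) h.
  apply: is_derive_eq; rewrite /GRing.scale /=; ring.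
have := @is_derive1_comp R g (fun s => x + s * h) t d h gd a.
by rewrite mulrC.
Qed.

Lemma taylor1 {R : realType} {g g1 : R -> R} {x h : R} :
  (forall t : R, 0 <= t <= 1 -> is_derive (x + t * h) 1 g (g1 (x + t * h))) ->
  exists2 t, 0 <= t <= 1 & g (x + h) = g x + h * g1 (x + t * h).
Proof.
move=> gd.
have d (t : R) : 0 <= t <= 1 -> is_derive t 1 (fun s => g (x + s * h)) (h * g1 (x + t * h)).
  by move=> /gd; exact: is_derive_affine_comp.
have [|||t t01 e] := @MVT_segment R (fun s => g (x + s * h)) (fun t : R => h * g1 (x + t * h)) 0 1.
- exact: ler01.
- by move=> t; rewrite in_itv /= => /andP[t0 t1]; apply: d; rewrite !ltW.
- apply: derivable_within_continuous => t; rewrite in_itv /= => t01.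
  by have [] := d t t01.
exists t; first by move: t01; rewrite in_itv.
by move: e; rewrite !mul1r mul0r addr0 subr0 mulr1 => <-; ring.
Qed.

Lemma taylor2 {R : realType} {g g1 g2 : R -> R} {x h : R} :
  (forall t : R, 0 <= t <= 1 -> is_derive (x + t * h) 1 g (g1 (x + t * h))) ->
  (forall t : R, 0 <= t <= 1 -> is_derive (x + t * h) 1 g1 (g2 (x + t * h))) ->
  exists2 t, 0 <= t <= 1 &
    g (x + h) = g x + h * g1 x + h ^+ 2 / 2 * g2 (x + t * h).
Proof.
move=> gd g1d.
(* [c] is the remainder to identify. The weight [(1 - t) ^+ 2] makes [k] equal to [g (x + h)] at
   both ends of [[0, 1]], and an interior zero of its derivative gives [h ^+ 2 * g2 = 2 * c]. *)
pose c := g (x + h) - g x - h * g1 x.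
pose k (t : R) := g (x + t * h) + (1 - t) * (h * g1 (x + t * h)) + (1 - t) ^+ 2 * c.
have kd (t : R) : 0 <= t <= 1 ->
    is_derive t 1 k ((1 - t) * (h ^+ 2 * g2 (x + t * h) - 2 * c)).
  move=> t01.
  have d1 := is_derive_affine_comp (gd t t01).
  have d2 := is_derive_affine_comp (g1d t t01).
  rewrite /k; apply: is_derive_eq.
  rewrite /GRing.scale /=; ring.
have [||||t] := @Rolle R k 0 1.
- exact: ltr01.
- by move=> t; rewrite in_itv /= => /andP[t0 t1]; have [|] := kd t; rewrite ?ltW.
- apply: derivable_within_continuous => t; rewrite in_itv /= => t01.
  by have [] := kd t t01.
- by rewrite /k /c !mul1r mul0r addr0 subr0 expr1n !mul1r subrr expr0n /= !mul0r; ring.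
rewrite in_itv /= => /andP[t0 t1] k0.
have t01 : 0 <= t <= 1 by rewrite !ltW.
have := kd t t01; move=> /@derive_val; rewrite derive_val.
move=> /esym/eqP; rewrite mulf_eq0 subr_eq0 gt_eqF //= subr_eq0 => /eqP e.
exists t => //.
have -> : h ^+ 2 / 2 * g2 (x + t * h) = c by rewrite mulrAC e; field.
by rewrite /c; ring.
Qed.

Lemma near_box {R : realType} {P : set (R * R)} {x y : R} :
  (\forall z \near (x, y), P z) ->
  exists2 r : R, 0 < r & forall s t, `|s| < r -> `|t| < r -> P (x + s, y + t).
Proof.
move=> /nbhs_ballP [r /= r0 rP]; exists r => // s t hs ht.
by apply: rP; split; rewrite /ball /= opprD addNKr normrN.
Qed.

Lemma derive0_local_max {R : realType} {g g1 : R -> R} {x r : R} :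
  0 < r ->
  (forall s, `|s| < r -> is_derive (x + s) 1 g (g1 (x + s)) /\ g (x + s) <= g x) ->
  g1 x = 0.
Proof.
move=> r0 gP.
have P t : t \in `]x - r, x + r[ -> is_derive t 1 g (g1 t) /\ g t <= g x.
  rewrite in_itv /= => /andP[h1 h2]; have -> : t = x + (t - x) by ring.
  by apply: gP; rewrite ltr_norml; lra.
have xx : x \in `]x - r, x + r[ by rewrite in_itv /=; lra.
have [gd _] := P _ xx.
have g0 : is_derive x 1 g 0.
  apply: (@derive1_at_max R g (x - r) (x + r)) => //; first lra.
  - by move=> t /P[[]].
  - by move=> t /P[].
by rewrite -(@derive_val _ _ _ _ _ _ _ gd) derive_val.
Qed.

(** Expanding first along [x] and then along [y] involves [u12] only, so no
    symmetry of second derivatives is needed. *)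
Lemma second_order_max {R : realType} {U : set (R * R)}
    {u u1 u2 u11 u12 u22 : R * R -> R} {x y : R} :
  open U -> U (x, y) ->
  (forall z, U z -> is_derive z.1 1 (fun t => u (t, z.2)) (u1 z)) ->
  (forall z, U z -> is_derive z.2 1 (fun t => u (z.1, t)) (u2 z)) ->
  (forall z, U z -> is_derive z.1 1 (fun t => u1 (t, z.2)) (u11 z)) ->
  (forall z, U z -> is_derive z.2 1 (fun t => u1 (z.1, t)) (u12 z)) ->
  (forall z, U z -> is_derive z.2 1 (fun t => u2 (z.1, t)) (u22 z)) ->
  {for (x, y), continuous u11} -> {for (x, y), continuous u12} ->
  {for (x, y), continuous u22} ->
  (\forall z \near (x, y), u z <= u (x, y)) ->
  [/\ u1 (x, y) = 0, u2 (x, y) = 0 &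
    forall a b, a ^+ 2 * u11 (x, y) + 2 * a * b * u12 (x, y)
                + b ^+ 2 * u22 (x, y) <= 0].
Proof.
move=> oU Uz d1 d2 d11 d12 d22 c11 c12 c22 umax.
have nU : \forall z \near (x, y), U z by exact: open_nbhs_nbhs.
have u10 : u1 (x, y) = 0.
  have [r r0 rP] := near_box (filterI nU umax).
  apply: (@derive0_local_max R (fun t => u (t, y)) (fun t => u1 (t, y)) x r) => //.
  move=> s sr; have [Us us] := rP s 0 sr ltac:(by rewrite normr0).
  by rewrite addr0 in Us us; split => //; exact: d1 _ Us.
have u20 : u2 (x, y) = 0.
  have [r r0 rP] := near_box (filterI nU umax).
  apply: (@derive0_local_max R (fun t => u (x, t)) (fun t => u2 (x, t)) y r) => //.
  move=> s sr; have [Us us] := rP 0 s ltac:(by rewrite normr0) sr.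
  by rewrite addr0 in Us us; split => //; exact: d2 _ Us.
split=> // a b; rewrite leNgt; apply/negP; set Q := (X in 0 < X) => Q0.
(* If the form is positive at [(a, b)], move from [(x, y)] by [(s a, s b)] with [s] small. The
   second derivatives vary by less than [e], which changes the form by at most [n ^+ 2 * e = Q / 2],
   so [u] would exceed its maximum. *)
pose n := `|a| + `|b| + 1.
have n1 : 1 <= n by rewrite /n lerDr addr_ge0.
have n0 : 0 < n by apply: lt_le_trans n1.
have [e e0 ne] : exists2 e, 0 < e & n ^+ 2 * e = Q / 2.
  exists (Q / (n ^+ 2 * 2)); first by rewrite divr_gt0 ?mulr_gt0 ?exprn_gt0.
  by field; rewrite gt_eqF.
have cP (w : R * R -> R) : {for (x, y), continuous w} ->
    \forall z \near (x, y), `|w (x, y) - w z| < e.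
  by move=> /cvgrPdist_lt; exact.
have [r r0 rP] := near_box (filterI (filterI nU umax)
   (filterI (cP _ c11) (filterI (cP _ c12) (cP _ c22)))).
have [s s0 sn] : exists2 s, 0 < s & s * n < r.
  exists (r / (n * 2)); first by rewrite divr_gt0 ?mulr_gt0.
  have -> : r / (n * 2) * n = r / 2 by field; rewrite gt_eqF.
  lra.
have sr (c t : R) : `|c| <= n -> 0 <= t <= 1 -> `|t * (s * c)| < r.
  move=> cn /andP[t0 t1].
  rewrite !normrM (ger0_norm t0) (gtr0_norm s0).
  apply: (@le_lt_trans _ _ (1 * (s * n))).
    by rewrite ler_pM ?mulr_ge0 ?(ltW s0)// ler_pM2l.
  by rewrite mul1r.
have an : `|a| <= n by rewrite /n -addrA lerDl addr_ge0.
have bn : `|b| <= n by rewrite /n -addrA addrCA lerDl addr_ge0.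
have sr1 (c : R) : `|c| <= n -> `|s * c| < r.
  by move=> cn; have := sr c 1 cn; rewrite mul1r; apply; rewrite ler01 lexx.
have rU (s' t : R) : `|s'| < r -> `|t| < r -> U (x + s', y + t).
  by move=> h1 h2; have [[]] := rP s' t h1 h2.
have [t1 t1i e1] : exists2 t, 0 <= t <= 1 & u (x + s * a, y + s * b) =
    u (x, y + s * b) + s * a * u1 (x, y + s * b)
    + (s * a) ^+ 2 / 2 * u11 (x + t * (s * a), y + s * b).
  apply: (@taylor2 R (fun t => u (t, y + s * b)) (fun t => u1 (t, y + s * b))
     (fun t => u11 (t, y + s * b))) => t ti.
    by apply: (d1 (_, _)); apply: rU; [exact: sr|exact: sr1].
  by apply: (d11 (_, _)); apply: rU; [exact: sr|exact: sr1].
have zr : `|0 : R| < r by rewrite normr0.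
have [t2 t2i e2] : exists2 t, 0 <= t <= 1 & u1 (x, y + s * b) =
    u1 (x, y) + s * b * u12 (x, y + t * (s * b)).
  apply: (@taylor1 R (fun t => u1 (x, t)) (fun t => u12 (x, t))) => t ti.
  by apply: (d12 (_, _)); rewrite -[x]addr0; apply: rU => //; exact: sr.
have [t3 t3i e3] : exists2 t, 0 <= t <= 1 & u (x, y + s * b) =
    u (x, y) + s * b * u2 (x, y)
    + (s * b) ^+ 2 / 2 * u22 (x, y + t * (s * b)).
  apply: (@taylor2 R (fun t => u (x, t)) (fun t => u2 (x, t))
     (fun t => u22 (x, t))) => t ti.
    by apply: (d2 (_, _)); rewrite -[x]addr0; apply: rU => //; exact: sr.
  by apply: (d22 (_, _)); rewrite -[x]addr0; apply: rU => //; exact: sr.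
have [[_ le0] _] := rP _ _ (sr1 a an) (sr1 b bn).
have [_ [k1 _]] := rP _ _ (sr a t1 an t1i) (sr1 b bn).
have [_ [_ [k2 _]]] := rP _ _ zr (sr b t2 bn t2i).
have [_ [_ [_ k3]]] := rP _ _ zr (sr b t3 bn t3i).
rewrite addr0 in k2 k3.
move: le0; rewrite e1 e2 e3 u10 u20.
set v11 := u11 (x + _, _) in k1 *; set v12 := u12 (_, y + _) in k2 *.
set v22 := u22 (_, y + _) in k3 *.
rewrite -subr_le0.
have -> : u (x, y) + s * b * 0 + (s * b) ^+ 2 / 2 * v22 +
   s * a * (0 + s * b * v12) + (s * a) ^+ 2 / 2 * v11 - u (x, y) =
   s ^+ 2 / 2 * (a ^+ 2 * v11 + 2 * a * b * v12 + b ^+ 2 * v22) by field.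
rewrite pmulr_rle0 ?divr_gt0 ?exprn_gt0//; apply/negP; rewrite -ltNge.
have -> : a ^+ 2 * v11 + 2 * a * b * v12 + b ^+ 2 * v22 =
  Q - (a ^+ 2 * (u11 (x, y) - v11) + 2 * a * b * (u12 (x, y) - v12) + b ^+ 2 * (u22 (x, y) - v22)).
  by rewrite /Q; ring.
rewrite subr_gt0 (le_lt_trans (ler_norm _))//.
apply: (@le_lt_trans _ _ (`|a| ^+ 2 * e + 2 * `|a| * `|b| * e + `|b| ^+ 2 * e)).
  rewrite (le_trans (ler_normD _ _))// lerD//.
    rewrite (le_trans (ler_normD _ _))// lerD//.
      by rewrite normrM normrX ler_wpM2l// ltW.
    by rewrite !normrM (@ger0_norm _ 2)// ler_wpM2l// ltW.
  by rewrite normrM normrX ler_wpM2l// ltW.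
have -> : `|a| ^+ 2 * e + 2 * `|a| * `|b| * e + `|b| ^+ 2 * e =
  (`|a| + `|b|) ^+ 2 * e by ring.
apply: (@le_lt_trans _ _ (n ^+ 2 * e)).
  by rewrite ler_pM2r// ler_sqr ?nnegrE ?addr_ge0 ?(ltW n0)// /n lerDl.
rewrite ne.
lra.
Qed.

(** * The inequality at a contact point, in vector algebra *)

(** The Hessian in space of the test function [quad m B1 B2] below; it depends neither on the point
    nor on [B1], [B2]. *)
Definition quad_hess {R : realType} (m : R) (v w : R * R * R) : R :=
  2 * (v.1.1 * w.1.1 + v.1.2 * w.1.2) - 2 * m * dot3 v w.

(** Trace the Hessian inequality with respect to the first fundamental form. The vector [g], an
    ambient gradient, is normal at a critical point, so its pairing with the second derivatives of
    the immersion is traced by the mean curvature equation to [k * g.2]. The horizontal part of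
    [quad_hess] has trace at least 2 on any plane, the remaining part trace [- 4 m]. *)
Lemma contact_inequality {R : realType} {Xu Xv Xuu Xuv Xvv n g : R * R * R}
    {m k : R} :
  cross3 Xu Xv <> (0, 0, 0) ->
  dot3 n n = 1 -> dot3 n Xu = 0 -> dot3 n Xv = 0 ->
  dot3 g Xu = 0 -> dot3 g Xv = 0 ->
  let E := dot3 Xu Xu in let F := dot3 Xu Xv in let G := dot3 Xv Xv in
  scale3 ((dot3 Xuu n * G - 2 * dot3 Xuv n * F + dot3 Xvv n * E)
          / (E * G - F ^+ 2)) n = scale3 (k * n.2) n ->
  (forall a b, a ^+ 2 * (quad_hess m Xu Xu + dot3 g Xuu)
    + 2 * a * b * (quad_hess m Xu Xv + dot3 g Xuv)
    + b ^+ 2 * (quad_hess m Xv Xv + dot3 g Xvv) <= 0) ->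
  1 <= 2 * m - k * g.2 / 2.
Proof.
move=> c0 nn nu nv gu gv E F G H.
set uu := _ + dot3 g Xuu; set uv := _ + dot3 g Xuv; set vv := _ + dot3 g Xvv => Q.
pose c := cross3 Xu Xv; pose W := E * G - F ^+ 2.
have WE : W = dot3 c c by rewrite /W /E /F /G /c /dot3 /cross3 /=; ring.
have W0 : 0 < W.
  rewrite WE lt_neqAle; apply/andP; split; last first.
    by rewrite /dot3 !addr_ge0 // -expr2 sqr_ge0.
  apply/eqP => e; apply: c0; move: e; rewrite -/c /dot3 -!expr2.
  case: (c) => [[c1 c2] c3] /= /esym/eqP.
  rewrite paddr_eq0 ?addr_ge0 ?sqr_ge0// paddr_eq0 ?sqr_ge0// !sqrf_eq0.
  by move=> /andP[/andP[/eqP-> /eqP->] /eqP->].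
have E0 : 0 < E.
  have : 0 <= E by rewrite /E /dot3 !addr_ge0 // -expr2 sqr_ge0.
  rewrite le_eqVlt => /orP[/eqP e|//].
  by move: W0; rewrite /W -e mul0r sub0r oppr_gt0 ltNge sqr_ge0.
pose l := dot3 g n.
(* Both [g] and [n] are normal to [Xu] and [Xv], hence [g = <g, n> n]. *)
have gE y : dot3 g y = l * dot3 y n.
  (* Pair [v] with the expansion of [w] in the basis [Xu], [Xv], [c]: only the [c] term survives. *)
  have K (v w : R * R * R) : dot3 v Xu = 0 -> dot3 v Xv = 0 -> W * dot3 v w = dot3 v c * dot3 c w.
    move=> vu vv'.
    have -> : W * dot3 v w = dot3 v c * dot3 c w
       + dot3 v Xu * (G * dot3 Xu w - F * dot3 Xv w)
       + dot3 v Xv * (E * dot3 Xv w - F * dot3 Xu w).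
      by rewrite /W /E /F /G /c /dot3 /cross3 /=; ring.
    by rewrite vu vv' !mul0r !addr0.
  have Kn := K n n nu nv; rewrite nn mulr1 in Kn.
  have dC (v w : R * R * R) : dot3 v w = dot3 w v by rewrite /dot3; ring.
  apply: (@mulfI _ W); first by rewrite gt_eqF.
  apply: (@mulfI _ W); first by rewrite gt_eqF.
  rewrite (K g y gu gv) {1}Kn.
  have -> : W * (W * (l * dot3 y n)) = (W * dot3 g n) * (W * dot3 n y).
    by rewrite (dC y n) /l; ring.
  by rewrite (K g n gu gv) (K n y nu nv); ring.
have g2 : g.2 = l * n.2.
  have := gE (0, 0, 1); rewrite /dot3 /= !mulr0 !add0r !mulr1 !mul0r !add0r mul1r.
  exact.
set S := _ + _ in H.
have SE : S = W * (k * n.2).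
  have := congr1 (fun v => dot3 v n) H.
  have dZ (a : R) : dot3 (scale3 a n) n = a.
    by rewrite -[RHS]mulr1 -nn /dot3 /scale3 /=; ring.
  by rewrite !dZ -/W => <-; field; rewrite gt_eqF.
(* Completing the square, [E] times the trace is the form at [(- F, E)] plus [W] times the form at
   [(1, 0)]. *)
have tr_le0 : G * uu - 2 * F * uv + E * vv <= 0.
  rewrite -(pmulr_rle0 _ E0).
  have -> : E * (G * uu - 2 * F * uv + E * vv) =
     ((- F) ^+ 2 * uu + 2 * (- F) * E * uv + E ^+ 2 * vv) + W * uu.
    by rewrite /W; ring.
  rewrite -[leRHS]addr0 lerD ?Q// pmulr_rle0//.
  by have := Q 1 0; rewrite expr1n expr0n /= mulr0 !mul0r !addr0 mul1r.
(* The form [2 (x^2 + y^2)] has trace [2 + 2 n_3^2] on the tangent plane, and [W n_3^2 = c.2 ^+ 2];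
   this square is then dropped. *)
have trE : G * uu - 2 * F * uv + E * vv = 2 * c.2 ^+ 2 + W * (2 - 4 * m + k * g.2).
  have -> : W * (2 - 4 * m + k * g.2) = W * (2 - 4 * m) + l * S.
    by rewrite SE g2; ring.
  rewrite /uu /uv /vv !gE /quad_hess /S /W /E /F /G /c /cross3 /dot3 /=; ring.
have : W * (2 - 4 * m + k * g.2) <= 0.
  by move: tr_le0; rewrite trE; have := sqr_ge0 c.2; lra.
rewrite pmulr_rle0//; lra.
Qed.

(** * The contact inequality in a chart *)

Lemma smooth_on_is_derive1 {R : realType} {U : set (R * R)} {g : R * R -> R} :
  smooth_on U g -> forall w z, U z ->
  is_derive z.1 1 (fun t => iter_pd w g (t, z.2)) (iter_pd (false :: w) g z).
Proof.
move=> sg w z Uz; have [_ d _] := sg w z Uz.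
by apply: DeriveDef => //; rewrite /= /pd1 derive1E.
Qed.

Lemma smooth_on_is_derive2 {R : realType} {U : set (R * R)} {g : R * R -> R} :
  smooth_on U g -> forall w z, U z ->
  is_derive z.2 1 (fun t => iter_pd w g (z.1, t)) (iter_pd (true :: w) g z).
Proof.
move=> sg w z Uz; have [_ _ d] := sg w z Uz.
by apply: DeriveDef => //; rewrite /= /pd2 derive1E.
Qed.

Lemma smooth_on_continuous {R : realType} {U : set (R * R)} {g : R * R -> R} :
  smooth_on U g -> forall w z, U z -> {for z, continuous (iter_pd w g)}.
Proof. by move=> sg w z /(sg w z)[]. Qed.

(** Up to an additive constant this is [h - K - m (1 + |X|^2)], where [B1] and [B2] are the linear
    coefficients of the barrier [h]. *)
Definition quad {R : realType} (m B1 B2 : R) (p : R * R * R) : R :=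
  p.1.1 * p.1.1 + p.1.2 * p.1.2 + B1 * p.1.1 + B2 * p.1.2 - m * dot3 p p.

Definition quad_grad {R : realType} (m B1 B2 : R) (p : R * R * R) : R * R * R :=
  (2 * (1 - m) * p.1.1 + B1, 2 * (1 - m) * p.1.2 + B2, - 2 * m * p.2).

Lemma is_derive_quad {R : realType} {m B1 B2 : R} {x y z : R -> R} {t dx dy dz : R} :
  is_derive t 1 x dx -> is_derive t 1 y dy -> is_derive t 1 z dz ->
  is_derive t 1 (fun s => quad m B1 B2 (x s, y s, z s))
    (dot3 (quad_grad m B1 B2 (x t, y t, z t)) (dx, dy, dz)).
Proof.
move=> hx hy hz; rewrite /quad /dot3 /=; apply: is_derive_eq.
by rewrite /quad_grad /GRing.scale /=; ring.
Qed.

Lemma is_derive_quad_grad {R : realType} {m B1 B2 : R} {x y z p q r : R -> R}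
    {t dx dy dz dp dq dr : R} :
  is_derive t 1 x dx -> is_derive t 1 y dy -> is_derive t 1 z dz ->
  is_derive t 1 p dp -> is_derive t 1 q dq -> is_derive t 1 r dr ->
  is_derive t 1 (fun s => dot3 (quad_grad m B1 B2 (x s, y s, z s)) (p s, q s, r s))
    (quad_hess m (p t, q t, r t) (dx, dy, dz) +
     dot3 (quad_grad m B1 B2 (x t, y t, z t)) (dp, dq, dr)).
Proof.
move=> hx hy hz hp hq hr; rewrite /quad_grad /dot3 /=; apply: is_derive_eq.
by rewrite /quad_hess /dot3 /GRing.scale /=; ring.
Qed.

Lemma continuous_quad_hess_grad {R : realType} {T : topologicalType} {t : T}
    {m B1 B2 : R} {x y z p q r p' q' r' a b c : T -> R} :
  {for t, continuous x} -> {for t, continuous y} -> {for t, continuous z} ->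
  {for t, continuous p} -> {for t, continuous q} -> {for t, continuous r} ->
  {for t, continuous p'} -> {for t, continuous q'} -> {for t, continuous r'} ->
  {for t, continuous a} -> {for t, continuous b} -> {for t, continuous c} ->
  {for t, continuous (fun s => quad_hess m (p s, q s, r s) (p' s, q' s, r' s) +
     dot3 (quad_grad m B1 B2 (x s, y s, z s)) (a s, b s, c s))}.
Proof.
move=> *; rewrite /quad_hess /quad_grad /dot3 /=.
by repeat (apply: cvgD || apply: cvgN || apply: cvgM || exact: cvg_cst || assumption).
Qed.

Lemma contact_in_chart {R : realType} {phi : R -> R} {M : topologicalType}
    {X N : M -> R * R * R} {U : set (R * R)} {psi : R * R -> M} {z0 : R * R}
    {m B1 B2 : R} :
  unit_normal X N -> phi_minimal phi X N -> immersion_chart X U psi -> U z0 ->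
  (\forall z \near z0, quad m B1 B2 (X (psi z)) <= quad m B1 B2 (X (psi z0))) ->
  1 <= m * (2 + (X (psi z0)).2 * derive1 phi (X (psi z0)).2).
Proof.
case: z0 => [u0 v0] [_ nn nT] mini ch Uz zmax.
have [[oU _ _ _] sx sy sz imm] := ch.
pose x z := (X (psi z)).1.1; pose y z := (X (psi z)).1.2; pose z z' := (X (psi z')).2.
pose Y w w' : R * R * R := (iter_pd w x w', iter_pd w y w', iter_pd w z w').
have XE w' : X (psi w') = Y [::] w'.
  by rewrite /Y /= /x /y /z; case: (X _) => [[]].
have cx w := smooth_on_continuous sx w _ Uz.
have cy w := smooth_on_continuous sy w _ Uz.
have cz w := smooth_on_continuous sz w _ Uz.
(* In these words [false] is the first chart variable, [true] the second, and the head is the last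
   derivative taken; [[:: true; false]] is thus the mixed derivative used in [mean_curv_vec]. *)
have [] := @second_order_max R U (quad m B1 B2 \o Y [::])
  (fun w => dot3 (quad_grad m B1 B2 (Y [::] w)) (Y [:: false] w))
  (fun w => dot3 (quad_grad m B1 B2 (Y [::] w)) (Y [:: true] w))
  (fun w => quad_hess m (Y [:: false] w) (Y [:: false] w) +
     dot3 (quad_grad m B1 B2 (Y [::] w)) (Y [:: false; false] w))
  (fun w => quad_hess m (Y [:: false] w) (Y [:: true] w) +
     dot3 (quad_grad m B1 B2 (Y [::] w)) (Y [:: true; false] w))
  (fun w => quad_hess m (Y [:: true] w) (Y [:: true] w) +
     dot3 (quad_grad m B1 B2 (Y [::] w)) (Y [:: true; true] w)) u0 v0 oU Uz.
- move=> [a b] Uw; exact: is_derive_quad (smooth_on_is_derive1 sx [::] _ Uw)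
    (smooth_on_is_derive1 sy [::] _ Uw) (smooth_on_is_derive1 sz [::] _ Uw).
- move=> [a b] Uw; exact: is_derive_quad (smooth_on_is_derive2 sx [::] _ Uw)
    (smooth_on_is_derive2 sy [::] _ Uw) (smooth_on_is_derive2 sz [::] _ Uw).
- move=> [a b] Uw; exact: is_derive_quad_grad
    (smooth_on_is_derive1 sx [::] _ Uw) (smooth_on_is_derive1 sy [::] _ Uw)
    (smooth_on_is_derive1 sz [::] _ Uw) (smooth_on_is_derive1 sx [:: false] _ Uw)
    (smooth_on_is_derive1 sy [:: false] _ Uw) (smooth_on_is_derive1 sz [:: false] _ Uw).
- move=> [a b] Uw; exact: is_derive_quad_grad
    (smooth_on_is_derive2 sx [::] _ Uw) (smooth_on_is_derive2 sy [::] _ Uw)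
    (smooth_on_is_derive2 sz [::] _ Uw) (smooth_on_is_derive2 sx [:: false] _ Uw)
    (smooth_on_is_derive2 sy [:: false] _ Uw) (smooth_on_is_derive2 sz [:: false] _ Uw).
- move=> [a b] Uw; exact: is_derive_quad_grad
    (smooth_on_is_derive2 sx [::] _ Uw) (smooth_on_is_derive2 sy [::] _ Uw)
    (smooth_on_is_derive2 sz [::] _ Uw) (smooth_on_is_derive2 sx [:: true] _ Uw)
    (smooth_on_is_derive2 sy [:: true] _ Uw) (smooth_on_is_derive2 sz [:: true] _ Uw).
- exact: continuous_quad_hess_grad (cx _) (cy _) (cz _) (cx _) (cy _) (cz _)
    (cx _) (cy _) (cz _) (cx _) (cy _) (cz _).
- exact: continuous_quad_hess_grad (cx _) (cy _) (cz _) (cx _) (cy _) (cz _)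
    (cx _) (cy _) (cz _) (cx _) (cy _) (cz _).
- exact: continuous_quad_hess_grad (cx _) (cy _) (cz _) (cx _) (cy _) (cz _)
    (cx _) (cy _) (cz _) (cx _) (cy _) (cz _).
- by apply: filterS zmax => w; rewrite /= -!XE.
move=> gu gv Q.
have [nu nv] := nT U psi ch _ Uz.
(* The vertical component of the gradient is [- 2 m z], so [- k g_3 / 2] becomes [m z phi'(z)]. *)
have := contact_inequality (imm _ Uz) (nn _) nu nv gu gv (mini U psi ch _ Uz) Q.
by rewrite /quad_grad /=; lra.
Qed.

(** * The barrier in the plane wedge *)

(** The line [l = l0] cuts a bounded triangle off the wedge. A positive maximum of [h] over the
    triangle avoids the cut, while nothing is asked of [h] on the sides of the wedge, since a
    surface inside the wedge has no boundary there. *)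
Lemma wedge_barrier {R : realType} {a1 b1 c1 a2 b2 c2 x0 y0 : R} :
  a1 * b2 - a2 * b1 <> 0 ->
  a1 * x0 + b1 * y0 <= c1 -> a2 * x0 + b2 * y0 <= c2 ->
  exists B1 B2 K l1 l2 l0 D : R,
    let h x y := x * x + y * y + B1 * x + B2 * y + K in
    [/\ 0 < h x0 y0, l1 * x0 + l2 * y0 < l0 &
      forall x y, a1 * x + b1 * y <= c1 -> a2 * x + b2 * y <= c2 ->
        l1 * x + l2 * y <= l0 ->
        h x y <= D /\ (l1 * x + l2 * y = l0 -> h x y <= 0)].
Proof.
move=> /eqP d0 s0 t0.
(* In the oblique coordinates [s, t >= 0] of the wedge, the squared Euclidean
   norm has quadratic part [E s^2 + F t^2 + 2 c s t]; on the segment [s + t = L]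
   the barrier is [- |e - f|^2 s t], where [e, f] is the basis dual to [s, t]. *)
pose d := a1 * b2 - a2 * b1.
pose s x y := c1 - a1 * x - b1 * y; pose t x y := c2 - a2 * x - b2 * y.
pose E := (a2 ^+ 2 + b2 ^+ 2) / d ^+ 2; pose F := (a1 ^+ 2 + b1 ^+ 2) / d ^+ 2.
pose c := - (a1 * a2 + b1 * b2) / d ^+ 2.
(* The given point has [s + t = L - 1], so the last term of [H] equals [k] there and
   [H = q0 + k > 0] by the choice of [k]. *)
pose L := s x0 y0 + t x0 y0 + 1.
pose q0 := E * s x0 y0 * (s x0 y0 - L) + F * t x0 y0 * (t x0 y0 - L)
  + 2 * c * s x0 y0 * t x0 y0.
pose k := `|q0| + 1.
(* As [k] varies, the zero sets of [H] are the circles through the two ends of the segment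
   [s + t = L], which is therefore a chord. *)
pose H s t := E * s * (s - L) + F * t * (t - L) + 2 * c * s * t + k * (L - s - t).
pose B1 := - (a1 * E * (2 * c1 - L)) - a2 * F * (2 * c2 - L)
   - 2 * c * (a1 * c2 + a2 * c1) + k * (a1 + a2).
pose B2 := - (b1 * E * (2 * c1 - L)) - b2 * F * (2 * c2 - L)
   - 2 * c * (b1 * c2 + b2 * c1) + k * (b1 + b2).
have HE x y : x * x + y * y + B1 * x + B2 * y + H c1 c2 = H (s x y) (t x y).
  rewrite /H /B1 /B2 /s /t /E /F /c /d; field; exact: d0.
have E0 : 0 <= E by rewrite divr_ge0 ?addr_ge0 ?sqr_ge0.
have F0 : 0 <= F by rewrite divr_ge0 ?addr_ge0 ?sqr_ge0.
have k0 : 0 < k by rewrite ltr_wpDl.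
(* [H c1 c2] is the value at the origin of the plane. The upper bound discards the [E] and [F]
   terms, nonpositive on the triangle, and uses [s t <= L^2]. *)
exists B1, B2, (H c1 c2), (- (a1 + a2)), (- (b1 + b2)), (L - c1 - c2),
  (2 * `|c| * L * L + k * L) => /=.
have st x y : - (a1 + a2) * x + - (b1 + b2) * y - (L - c1 - c2) = s x y + t x y - L.
  by rewrite /s /t; ring.
split.
- rewrite HE; have -> : H (s x0 y0) (t x0 y0) = q0 + k by rewrite /H /q0 /L; ring.
  by rewrite /k; have := ler_norm (- q0); rewrite normrN; lra.
- by rewrite -subr_lt0 st /L; lra.
move=> x y sx ty; rewrite -subr_le0 st => stL.
have s_ge0 : 0 <= s x y by rewrite /s; lra.
have t_ge0 : 0 <= t x y by rewrite /t; lra.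
rewrite HE; split; last first.
  move=> /eqP; rewrite -subr_eq0 st subr_eq0 => /eqP e.
  rewrite /H -e.
  have -> : E * s x y * (s x y - (s x y + t x y)) + F * t x y * (t x y - (s x y + t x y))
    + 2 * c * s x y * t x y + k * (s x y + t x y - s x y - t x y) =
    - (((a1 + a2) ^+ 2 + (b1 + b2) ^+ 2) / d ^+ 2 * (s x y * t x y)).
    by rewrite /E /F /c; field; exact: d0.
  rewrite oppr_le0 mulr_ge0//; first by rewrite divr_ge0 ?addr_ge0 ?sqr_ge0.
  exact: mulr_ge0.
rewrite /H; move: (s x y) (t x y) s_ge0 t_ge0 stL => u v u_ge0 v_ge0 stL.
have h1 : E * u * (u - L) <= 0 by apply: mulr_ge0_le0; [exact: mulr_ge0|move: stL v_ge0 u_ge0; clearbody L; lra].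
have h2 : F * v * (v - L) <= 0 by apply: mulr_ge0_le0; [exact: mulr_ge0|move: stL v_ge0 u_ge0; clearbody L; lra].
have h3 : 2 * c * u * v <= 2 * `|c| * L * L.
  have st2 : u * v <= L * L by apply: ler_pM => //; lra.
  have -> : 2 * c * u * v = 2 * (c * (u * v)) by ring.
  have -> : 2 * `|c| * L * L = 2 * (`|c| * (L * L)) by ring.
  rewrite ler_pM2l// (@le_trans _ _ (`|c| * (u * v)))//.
    by rewrite ler_wpM2r ?mulr_ge0// ler_norm.
  by rewrite ler_wpM2l.
have h4 : k * (L - u - v) <= k * L by rewrite ler_pM2l//; lra.
lra.
Qed.

(** * Continuity on the surface and attainment of the maximum *)

(** Charts are open maps, so they carry a neighbourhood of [z] on which [f \o psi] stays in [V] to a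
    neighbourhood of [psi z]. *)
Lemma continuous_chart {M T : topologicalType} {R : realType}
    {U : set (R * R)} {psi : R * R -> M} {f : M -> T} {z : R * R} :
  is_chart U psi -> U z -> {for z, continuous (f \o psi)} ->
  {for psi z, continuous f}.
Proof.
move=> [oU _ _ op] Uz cf V /cf; rewrite /= => nV.
have [W [oWz WV]] : exists W, open_nbhs z W /\ W `<=` U `&` (f \o psi) @^-1` V.
  have : nbhs z (U `&` (f \o psi) @^-1` V) by apply: filterI => //; exact: open_nbhs_nbhs.
  by rewrite nbhsE => -[W ? ?]; exists W.
rewrite nbhs_filterE nbhsE; exists (psi @` W).
  case: oWz => oW Wz; split; last by exists z.
  by apply: op => // w /WV[].
by move=> _ [w /WV[_ Vw] <-].
Qed.

Lemma near_chart {M : topologicalType} {R : realType}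
    {U : set (R * R)} {psi : R * R -> M} {P : set M} {z : R * R} :
  is_chart U psi -> U z -> (\forall p \near psi z, P p) ->
  \forall w \near z, P (psi w).
Proof.
move=> [oU _ cpsi _] Uz nP.
move: cpsi; rewrite continuous_open_subspace// => /(_ z).
by rewrite inE => /(_ Uz _ nP).
Qed.

Lemma ratio_max {R : realType} {M : topologicalType} {h s : M -> R} {A : set M}
    {K S : R} {p1 : M} :
  continuous h -> continuous s -> closed A -> (forall p, 1 <= s p) ->
  (forall r, compact [set p | s p <= r]) -> (forall p, A p -> h p <= S) ->
  A p1 -> K < h p1 ->
  exists p m, [/\ A p, 0 < m, h p - K = m * s p &
    forall q, A q -> h q - K <= m * s q].
Proof.
move=> ch cs cA s1 cpt hS Ap1 Kp1.
have s0 p : 0 < s p by apply: lt_le_trans (s1 p).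
pose f p := (h p - K) / s p.
have cf : continuous f.
  move=> p; apply: cvgM; first by apply: cvgB; [exact: ch|exact: cvg_cst].
  by apply: cvgV; [rewrite gt_eqF|exact: cs].
have f0 : 0 < f p1 by rewrite divr_gt0 ?subr_gt0.
(* Where [s > r], the quotient is at most [f p1], because [h - K <= S - K]; taking [r] at least
   [s p1] keeps [p1] in the compact set. *)
pose r := Num.max (s p1) ((S - K) / f p1).
have A0 : [set p | s p <= r] `&` A !=set0.
  by exists p1; split; rewrite //= /r le_max lexx.
have [p + pmax] := compact_EVT_max A0 (compact_closedI (cpt r) cA)
  (continuous_subspaceT cf).
rewrite inE => -[_ Ap].
have p1p : f p1 <= f p by apply: pmax; rewrite inE; split => //=; rewrite /r le_max lexx.
exists p, (f p); split => //; first exact: lt_le_trans p1p.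
  by rewrite /f divfK ?gt_eqF.
move=> q Aq; rewrite -ler_pdivrMr//.
have [sq|sq] := leP (s q) r; first by apply: pmax; rewrite inE.
apply: le_trans p1p; rewrite ler_pdivrMr//.
apply: (@le_trans _ _ (S - K)); first by rewrite lerB ?hS.
rewrite mulrC -ler_pdivrMr//; apply: ltW; apply: le_lt_trans sq.
by rewrite /r le_max lexx orbT.
Qed.

Lemma immersed_surface_continuous {R : realType} {M : topologicalType}
    {X : M -> R * R * R} : immersed_surface X ->
  [/\ continuous (fun p => (X p).1.1), continuous (fun p => (X p).1.2) &
    continuous (fun p => (X p).2)].
Proof.
move=> [_ charts]; split=> p;
  have [U [psi [[ch sx sy sz _] [w Uw <-]]]] := charts p;
  apply: (continuous_chart ch Uw).
- exact: (smooth_on_continuous sx [::] _ Uw).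
- exact: (smooth_on_continuous sy [::] _ Uw).
- exact: (smooth_on_continuous sz [::] _ Uw).
Qed.

Lemma proper_sublevel_compact {R : realType} {M : topologicalType}
    {X : M -> R * R * R} {r : R} :
  proper_map X -> continuous (fun p => 1 + dot3 (X p) (X p)) ->
  compact [set p | 1 + dot3 (X p) (X p) <= r].
Proof.
move=> pX cs.
pose I : set R := `[- r, r]%classic.
have cI : compact I by exact: segment_compact.
have cB := pX _ (compact_setX (compact_setX cI cI) cI).
apply: subclosed_compact cB _.
  by apply: (@preimage_closed _ _ _ [set y | y <= r]) => [p _|]; [exact: cs|exact: closed_le].
move=> p /=; rewrite /dot3; move: (X p) => [[x y] z] /= h.
(* These squares give [2 |u| <= 1 + u^2 <= r] for each coordinate [u], so the sublevel set lies in
   the preimage of a cube. *)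
have sq (u : R) : 0 <= (1 - u) ^+ 2 /\ 0 <= (1 + u) ^+ 2 by split; exact: sqr_ge0.
have [x1 x2] := sq x; have [y1 y2] := sq y; have [z1 z2] := sq z.
have [x3 y3 z3] := And3 (sqr_ge0 x) (sqr_ge0 y) (sqr_ge0 z).
by split; [split|]; rewrite /I /= in_itv /=; apply/andP; split; nra.
Qed.

(** * Contradiction at the maximum of the quotient *)

Theorem theoremB (R : realType) (phi : R -> R) (M : topologicalType)
    (X : M -> (R * R * R)%type) (N : M -> (R * R * R)%type)
    (a1 b1 c1 a2 b2 c2 : R) :
  (forall (n : nat) (t : R), derivable (derive1n n phi) t 1) ->
  (exists C : R, 0 < C /\ forall t : R, `|derive1 phi t| <= C * (1 + `|t|)) ->
  inhabited M ->
  connected [set: M] ->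
  immersed_surface X ->
  unit_normal X N ->
  proper_map X ->
  phi_minimal phi X N ->
  (a1, b1) <> (0, 0) ->
  (a2, b2) <> (0, 0) ->
  a1 * b2 - a2 * b1 <> 0 ->
  ~ (X @` [set: M] `<=` vert_halfspace a1 b1 c1 `&` vert_halfspace a2 b2 c2).
Proof.
move=> _ [C [C0 phiC]] [p0] _ iX uN pX mini _ _ d0 sub.
have [cx cy cz] := immersed_surface_continuous iX.
have wedge p : a1 * (X p).1.1 + b1 * (X p).1.2 <= c1 /\
    a2 * (X p).1.1 + b2 * (X p).1.2 <= c2.
  by have [] := sub (X p) (ex_intro2 _ _ p I erefl).
have [B1 [B2 [K0 [l1 [l2 [l0 [D /= [h0 lp0 hP]]]]]]]] :=
  wedge_barrier d0 (wedge p0).1 (wedge p0).2.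
pose h p := (X p).1.1 * (X p).1.1 + (X p).1.2 * (X p).1.2
  + B1 * (X p).1.1 + B2 * (X p).1.2 + K0.
pose l p := l1 * (X p).1.1 + l2 * (X p).1.2.
pose s p := 1 + dot3 (X p) (X p).
have ch : continuous h.
  by move=> p; repeat (apply: cvgD || apply: cvgM || exact: cvg_cst
    || exact: cx || exact: cy).
have cl : continuous l.
  by move=> p; repeat (apply: cvgD || apply: cvgM || exact: cvg_cst
    || exact: cx || exact: cy).
have cs : continuous s.
  by move=> p; repeat (apply: cvgD || apply: cvgM || exact: cvg_cst
    || exact: cx || exact: cy || exact: cz).
pose A := [set p | l p <= l0].
have cA : closed A by apply: (@preimage_closed _ _ l [set y | y <= l0]) => [p _|]; [exact: cl|exact: closed_le].
have hsup : has_sup (h @` A).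
  split; first by exists (h p0), p0 => //; exact: ltW.
  by exists D => _ [p lp <-]; have [] := hP _ _ (wedge p).1 (wedge p).2 lp.
pose S := sup (h @` A).
have hS p : A p -> h p <= S by move=> Ap; apply: ub_le_sup; [case: hsup|exists p].
have S0 : 0 < S by apply: lt_le_trans h0 (hS p0 (ltW lp0)).
(* The level is [K = S - e]. The bound [e <= S] makes it nonnegative, and [e <= 1 / (4 + 4 * C)]
   will bring the contact inequality down to [1 <= 1 / 2]. *)
pose e := Num.min S (1 / (4 + 4 * C)).
have e0 : 0 < e by rewrite lt_min S0 divr_gt0//; lra.
have [_ [p1 Ap1 <-] hp1] := sup_adherent e0 hsup.
have s1 p : 1 <= s p by rewrite lerDl /dot3 !addr_ge0// -expr2 sqr_ge0.
have [p [m [Ap m0 hm mmax]]] := ratio_max ch cs cA s1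
  (fun r => proper_sublevel_compact pX cs) hS Ap1 hp1.
have hp_gt0 : 0 < h p.
  have : 0 < m * s p by rewrite mulr_gt0// (lt_le_trans _ (s1 p)).
  have : e <= S by rewrite ge_min lexx.
  by rewrite -hm -/S; lra.
(* Since [h p > 0], the maximum is off the cut, so [A] contains a neighbourhood of [p] and the
   maximum over [A] is a local one on the whole surface. *)
have lp : l p < l0.
  rewrite lt_neqAle Ap andbT; apply/eqP => lp.
  have [_ /(_ lp)] := hP _ _ (wedge p).1 (wedge p).2 Ap.
  by rewrite leNgt hp_gt0.
have qmax : \forall q \near p, quad m B1 B2 (X q) <= quad m B1 B2 (X p).
  have : \forall q \near p, l q < l0 by exact: (cl p) _ (lt_nbhsl lp).
  apply: filterS => q /ltW /mmax; move: hm; rewrite /h /s /quad; lra.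
have [U [psi [chart [z Uz zp]]]] := iX.2 p.
have := contact_in_chart uN mini chart Uz.
move=> /(_ m B1 B2); rewrite zp.
have zmax : \forall w \near z, quad m B1 B2 (X (psi w)) <= quad m B1 B2 (X p).
  have [ch' _ _ _ _] := chart.
  by apply: (near_chart ch' Uz (P := fun q => quad m B1 B2 (X q) <= quad m B1 B2 (X p)));
    rewrite zp.
move=> /(_ zmax).
have ms : m * s p <= 1 / (4 + 4 * C).
  rewrite -hm; have : e <= 1 / (4 + 4 * C) by rewrite ge_min lexx orbT.
  by have := hS p Ap; rewrite -/S; lra.
(* With [a = |z|], the growth bound gives [C (a + a^2)], and [2 a <= 1 + a^2]. *)
have zphi : (X p).2 * derive1 phi (X p).2 <= 2 * C * s p.
  apply: le_trans (ler_norm _) _; rewrite normrM.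
  have : `|(X p).2| ^+ 2 <= dot3 (X p) (X p).
    by rewrite real_normK ?num_real// /dot3 expr2 lerDr addr_ge0// -expr2 sqr_ge0.
  have := phiC (X p).2; rewrite /s.
  move: (normr_ge0 (X p).2) (normr_ge0 (derive1 phi (X p).2)).
  move: `|(X p).2| `|derive1 phi (X p).2| (dot3 _ _) => a b c a_ge0 b_ge0 bC ac.
  apply: (@le_trans _ _ (a * (C * (1 + a)))); first by rewrite ler_wpM2l.
  have -> : a * (C * (1 + a)) = C * (a + a ^+ 2) by ring.
  rewrite -mulrA mulrCA ler_pM2l//; have := sqr_ge0 (1 - a); nra.
apply/negP; rewrite -ltNge.
apply: (@le_lt_trans _ _ ((m * s p) * (2 + 2 * C))).
  rewrite -mulrA ler_pM2l//.
  have -> : s p * (2 + 2 * C) = 2 * s p + 2 * C * s p by ring.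
  by apply: lerD => //; have := s1 p; lra.
apply: (@le_lt_trans _ _ (1 / (4 + 4 * C) * (2 + 2 * C))).
  by rewrite ler_pM2r//; lra.
have -> : 1 / (4 + 4 * C) * (2 + 2 * C) = 1 / 2 by field; rewrite gt_eqF//; lra.
lra.
Qed.
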